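(* For every $X\in ES$, the class of single-coalition-first action $X$-models is $z$-representable by the class of single-coalition-first neighborhood $X$-models; that is, every single-coalition-first action $X$-model is $z$-representable by some single-coalition-first neighborhood $X$-model, and every single-coalition-first neighborhood $X$-model $z$-represents some single-coalition-first action $X$-model.
   Context: $AG$ is a finite nonempty set of agents, $AP$ a countable set of atomic propositions. For a nonempty set $AC$ and $C\subseteq AG$, $JA_C$ is the set of functions $\sigma_C:C\to AC$ ($JA_\emptyset=\{\emptyset\}$); $\sigma_C|_{\{a\}}$ is the restriction to $\{a\}$; for disjoint $C,D$, $\sigma_C\cup\sigma_D\in JA_{C\cup D}$. A single-coalition-first action model is $M=(ST,AC,suc,\{out_a\}_{a\in AG},L)$ with $ST,AC$ nonempty, $suc:ST\to\mathcal P(ST)$, $out_a:ST\times JA_{\{a\}}\to\mathcal P(ST)$ with $\bigcup\{out_a(s,\sigma_a)\mid\sigma_a\in JA_{\{a\}}\}=suc(s)$ for all $s$, $L:ST\to\mathcal P(AP)$. It determines $out_\emptyset(s,\emptyset)=suc(s)$, $out_C(s,\sigma_C)=\bigcap\{out_a(s,\sigma_C|_{\{a\}})\mid a\in C\}$ for nonempty $C$, $av_C(s)=\{\sigma_C\mid out_C(s,\sigma_C)\neq\emptyset\}$, $AE_C(s)=\{out_C(s,\sigma_C)\mid\sigma_C\in av_C(s)\}$. $M$ is serial if $av_C(s)\neq\emptyset$ for all $C,s$; independent if for all $s$, disjoint $C,D$, $\sigma_C\in av_C(s)$, $\sigma_D\in av_D(s)$: $\sigma_C\cup\sigma_D\in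 av_{C\cup D}(s)$; deterministic if $out_{AG}(s,\sigma_{AG})$ is a singleton for all $s$ and $\sigma_{AG}\in av_{AG}(s)$. A single-coalition-first neighborhood model is $N=(ST,suc,\{nei_a\}_{a\in AG},L)$ with $ST$ nonempty, $suc:ST\to\mathcal P(ST)$, $L:ST\to\mathcal P(AP)$, $nei_a(s)\subseteq\mathcal P(ST)$ a cover of $suc(s)$ (union $suc(s)$, $\emptyset\notin nei_a(s)$). With $\Delta_1\odot\Delta_2=\{Y_1\cap Y_2\mid Y_i\in\Delta_i,Y_1\cap Y_2\neq\emptyset\}$ (extended to finitely many families, $\bigodot\{\Delta\}=\Delta$): $nei_C(s)=\emptyset$ if $suc(s)=\emptyset$; $\{suc(s)\}$ if $suc(s)\neq\emptyset$, $C=\emptyset$; $\bigodot\{nei_a(s)\mid a\in C\}$ otherwise. $N$ is serial if $nei_C(s)\neq\emptyset$ for all $C,s$; independent if for all $s$, disjoint $C,D$, $Y_1\in nei_C(s)$, $Y_2\in nei_D(s)$: $Y_1\cap Y_2\neq\emptyset$; deterministic if every $Y\in nei_{AG}(s)$ is a singleton. $ES=\{\epsilon,\mathtt S,\mathtt I,\mathtt D,\mathtt{SI},\mathtt{SD},\mathtt{ID},\mathtt{SID}\}$; an $X$-model has the properties whose letters ($\mathtt S$, $\mathtt I$, $\mathtt D$) occur in $X$. $M$ is $z$-representable by $N$ ($N$ $z$-represents $M$) if they share $ST$ and $L$ and $AE_C=nei_C$ for all $C\subseteq AG$. *)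

(* Defs.v *)
From mathcomp Require Import all_boot.
From mathcomp Require Import boolp classical_sets.

Set Implicit Arguments.
Unset Strict Implicit.
Unset Printing Implicit Defensive.

Local Open Scope classical_set_scope.

Section JointActions.
Variables (AG : finType) (AC : Type).

Definition JA (C : {set AG}) : Type := {a : AG | a \in C} -> AC.

Definition ja_restr (C D : {set AG}) (sDC : D \subset C) (sg : JA C) : JA D :=
  fun x => sg (exist _ (val x) (fintype.subsetP sDC (val x) (valP x))).

Fact sub_set1 (C : {set AG}) (a : AG) : a \in C -> [set a]%SET \subset C.
Proof. by rewrite finset.sub1set. Qed.

Definition ja_restr1 (C : {set AG}) (a : {a : AG | a \in C}) (sg : JA C) :
  JA [set val a]%SET := ja_restr (sub_set1 (valP a)) sg.

Fact setU_right (C D : {set AG}) (a : AG) :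
  a \in (C :|: D)%SET -> a \notin C -> a \in D.
Proof. by rewrite finset.in_setU => /orP[->|]. Qed.

(* Left-biased on C :&: D; only used for disjoint C and D. *)
Definition ja_union (C D : {set AG}) (sg : JA C) (tau : JA D) :
    JA (C :|: D)%SET :=
  fun x => match boolP (val x \in C) with
           | AltTrue h => sg (exist _ (val x) h)
           | AltFalse h => tau (exist _ (val x) (setU_right (valP x) h))
           end.

End JointActions.
Arguments ja_restr1 {AG AC C} a sg.

(* The state space is a parameter, so that an action model and a neighborhood
   model having the same states is a matter of typing. *)
Record action_model (AG : finType) (AP : countType) (ST : Type) := ActionModel {
  am_ST_inh : inhabited ST;
  am_AC : Type;
  am_AC_inh : inhabited am_AC;
  am_suc : ST -> set ST;
  am_out1 : forall a : AG, ST -> JA am_AC [set a]%SET -> set ST;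
  am_L : ST -> set AP;
  am_cover : forall (a : AG) (s : ST),
    \bigcup_(sg : JA am_AC [set a]%SET) am_out1 s sg = am_suc s }.
Arguments am_out1 {AG AP ST} M a s sg : rename.

Section ActionModel.
Variables (AG : finType) (AP : countType) (ST : Type).
Variable M : action_model AG AP ST.

Definition am_out (C : {set AG}) (s : ST) (sg : JA (am_AC M) C) : set ST :=
  if C == finset.set0 then am_suc M s
  else \bigcap_(a : {a : AG | a \in C}) am_out1 M (val a) s (ja_restr1 a sg).

Definition am_av (C : {set AG}) (s : ST) : set (JA (am_AC M) C) :=
  [set sg | am_out s sg !=set0].
Arguments am_av : clear implicits.

Definition am_AE (C : {set AG}) (s : ST) : set (set ST) :=
  [set am_out s sg | sg in am_av C s].

Definition am_serial : Prop :=
  forall (C : {set AG}) (s : ST), am_av C s !=set0.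

Definition am_independent : Prop :=
  forall (s : ST) (C D : {set AG}), [disjoint C & D]%B ->
  forall (sg : JA (am_AC M) C) (tau : JA (am_AC M) D),
    am_av C s sg -> am_av D s tau -> am_av (C :|: D)%SET s (ja_union sg tau).

Definition am_deterministic : Prop :=
  forall (s : ST) (sg : JA (am_AC M) [set: AG]%SET),
    am_av [set: AG]%SET s sg -> exists t : ST, am_out s sg = [set t].

End ActionModel.
Arguments am_out {AG AP ST} M C s sg.
Arguments am_av {AG AP ST} M C s.

Definition odot (T : Type) (D1 D2 : set (set T)) : set (set T) :=
  [set Y | exists Y1 Y2, [/\ D1 Y1, D2 Y2, Y = Y1 `&` Y2 & Y1 `&` Y2 !=set0]].

(* D_1 odot ... odot D_n. By odotC and odotA the order of the families is
   irrelevant; there is no empty product, and the value at [::] is unused. *)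
Definition bigodot (T : Type) (Ds : seq (set (set T))) : set (set T) :=
  if Ds is D :: Ds' then foldl (@odot T) D Ds' else set0.

Lemma odotC (T : Type) : commutative (@odot T).
Proof.
by move=> D1 D2; apply/seteqP; split=> Y [Y1 [Y2 [h1 h2 -> h]]];
  exists Y2, Y1; split; rewrite // classical_sets.setIC.
Qed.

Lemma odotA (T : Type) : associative (@odot T).
Proof.
move=> D1 D2 D3; apply/seteqP; split=> Y.
- move=> [Y1 [_ [h1 [Y2 [Y3 [h2 h3 -> _]]] -> h]]].
  rewrite classical_sets.setIA in h *.
  exists (Y1 `&` Y2), Y3; split=> //; exists Y1, Y2; split=> //.
  by case: h => x [hx _]; exists x.
- move=> [_ [Y3 [[Y1 [Y2 [h1 h2 -> _]]] h3 -> h]]].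
  rewrite -classical_sets.setIA in h *.
  exists Y1, (Y2 `&` Y3); split=> //; exists Y2, Y3; split=> //.
  by case: h => x [_ hx]; exists x.
Qed.

Record nbhd_model (AG : finType) (AP : countType) (ST : Type) := NbhdModel {
  nm_ST_inh : inhabited ST;
  nm_suc : ST -> set ST;
  nm_nei1 : AG -> ST -> set (set ST);
  nm_L : ST -> set AP;
  nm_cover : forall (a : AG) (s : ST),
    \bigcup_(Y in nm_nei1 a s) Y = nm_suc s;
  nm_nonempty : forall (a : AG) (s : ST), ~ nm_nei1 a s set0 }.

Section NbhdModel.
Variables (AG : finType) (AP : countType) (ST : Type).
Variable N : nbhd_model AG AP ST.

(* The product is indexed by the agents of C: two agents with the same
   neighborhoods contribute two factors. *)
Definition nm_nei (C : {set AG}) (s : ST) : set (set ST) :=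
  if `[< nm_suc N s = set0 >] then set0
  else if C == finset.set0 then [set nm_suc N s]
  else bigodot [seq nm_nei1 N a s | a <- enum C].

Definition nm_serial : Prop :=
  forall (C : {set AG}) (s : ST), nm_nei C s !=set0.

Definition nm_independent : Prop :=
  forall (s : ST) (C D : {set AG}), [disjoint C & D]%B ->
  forall Y1 Y2 : set ST, nm_nei C s Y1 -> nm_nei D s Y2 -> Y1 `&` Y2 !=set0.

Definition nm_deterministic : Prop :=
  forall (s : ST) (Y : set ST),
    nm_nei [set: AG]%SET s Y -> exists t : ST, Y = [set t].

End NbhdModel.

Inductive ES : Set :=
  ES_eps | ES_S | ES_I | ES_D | ES_SI | ES_SD | ES_ID | ES_SID.

Definition has_S (X : ES) : bool :=
  match X with ES_S | ES_SI | ES_SD | ES_SID => true | _ => false end.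

Definition has_I (X : ES) : bool :=
  match X with ES_I | ES_SI | ES_ID | ES_SID => true | _ => false end.

Definition has_D (X : ES) : bool :=
  match X with ES_D | ES_SD | ES_ID | ES_SID => true | _ => false end.

Definition action_X_model (AG : finType) (AP : countType) (ST : Type)
    (X : ES) (M : action_model AG AP ST) : Prop :=
  [/\ has_S X -> am_serial M,
      has_I X -> am_independent M
    & has_D X -> am_deterministic M].

Definition nbhd_X_model (AG : finType) (AP : countType) (ST : Type)
    (X : ES) (N : nbhd_model AG AP ST) : Prop :=
  [/\ has_S X -> nm_serial N,
      has_I X -> nm_independent N
    & has_D X -> nm_deterministic N].

Definition z_representable (AG : finType) (AP : countType) (ST : Type)
    (M : action_model AG AP ST) (N : nbhd_model AG AP ST) : Prop :=
  am_L M = nm_L N /\ forall C : {set AG}, am_AE M C = nm_nei N C.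

(* Main.v *)
Require Import Defs.
From mathcomp Require Import all_boot.
From mathcomp Require Import boolp classical_sets.

Set Implicit Arguments.
Unset Strict Implicit.
Unset Printing Implicit Defensive.

(** Both kinds of models are determined by their single-agent data: a set is in
    [AE_C(s)] (resp. [nei_C(s)]) iff it is nonempty and of the form
    [suc(s) `&` \bigcap_(a in C) F a] with [F a] in [AE_a(s)] (resp. [nei_a(s)]).
    Hence [M] is z-represented by [N] as soon as [AE_a = nei_a] for all agents,
    and then seriality, independence and determinism transfer both ways.  From
    [M], take [nei_a := AE_a]; from [N], let the actions be arbitrary sets [Y] of
    states, with outcome [Y] when [Y] is in [nei_a(s)] and the empty set
    otherwise. *)

Local Open Scope classical_set_scope.

(** * Joint actions as restrictions of total functions on agents *)

Definition ja_of (AG : finType) (AC : Type) (g : AG -> AC) (C : {set AG}) :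
  JA AC C := fun x => g (val x).
Arguments ja_of {AG AC} g C.

(** Extending by a default action outside [C] lets joint actions be handled as total functions, free
    of membership proofs. *)
Lemma ja_ofP (AG : finType) (AC : Type) (C : {set AG}) (sg : JA AC C) :
  inhabited AC -> exists g, sg = ja_of g C.
Proof.
case=> c; exists (fun a => oapp sg c (insub a)).
by apply/funext => x; rewrite /ja_of valK.
Qed.

Lemma ja_union_of (AG : finType) (AC : Type) (C D : {set AG})
    (g h : AG -> AC) :
  ja_union (ja_of g C) (ja_of h D) =
  ja_of (fun a => if a \in C then g a else h a) (C :|: D)%SET.
Proof.
apply/funext => x; rewrite /ja_union /ja_of.
destruct (boolP (val x \in C)) as [h0|h0]; by rewrite ?h0 ?(negPf h0).
Qed.

Definition am_out_of (AG : finType) (AP : countType) (ST : Type)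
    (M : action_model AG AP ST) (s : ST) (g : AG -> am_AC M) (a : AG) : set ST :=
  am_out1 M a s (ja_of g [set a]%SET).

(** * Outcomes and actual effects of coalitions *)

Section ActionModelTheory.
Variables (AG : finType) (AP : countType) (ST : Type).
Variable M : action_model AG AP ST.
Implicit Types (C D : {set AG}) (s : ST).

Lemma am_out1_sub (a : AG) s sg : am_out1 M a s sg `<=` am_suc M s.
Proof. by move=> t ?; rewrite -(am_cover M a s); exists sg. Qed.

(** The factor [am_suc M s] accounts for the empty coalition; for nonempty [C] it changes nothing,
    since every individual outcome set lies in it. One formula thus covers both cases. *)
Lemma am_outE C s (g : AG -> am_AC M) :
  am_out M C s (ja_of g C) =
  am_suc M s `&` \bigcap_(a in [set` C]) am_out_of s g a.
Proof.
rewrite /am_out; case: eqP => [->|/eqP/set0Pn[b bC]].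
  by apply/seteqP; split=> [t st|t []//]; split=> // a /=; rewrite finset.inE.
apply/seteqP; split=> [t ht|t [_ ht] [a aC] _]; last exact: ht.
split=> [|a aC]; last exact: (ht (exist _ a aC) I).
exact: am_out1_sub (ht (exist _ b bC) I).
Qed.

Lemma am_outU C D s (sg : JA (am_AC M) C) (tau : JA (am_AC M) D) :
  [disjoint C & D]%B ->
  am_out M (C :|: D)%SET s (ja_union sg tau) =
  am_out M C s sg `&` am_out M D s tau.
Proof.
move=> dCD; have [[g ->] [h ->]] := (ja_ofP sg (am_AC_inh M),
  ja_ofP tau (am_AC_inh M)).
rewrite ja_union_of !am_outE.
(* The outcome for [a] depends on [k] only through [k a], so the case distinction inside the union
   can be resolved agent by agent. *)
have out_eq a k : am_out_of s k a = am_out1 M a s (fun=> k a).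
  congr am_out1; apply/funext => -[b hb]; rewrite /ja_of /=.
  by move/finset.set1P: hb => ->.
apply/seteqP; split=> t.
  move=> [st ht]; split; split=> // a /= aX;
    have := ht a; rewrite /= finset.in_setU aX ?orbT !out_eq => /(_ isT) //.
    by rewrite aX.
  by rewrite (disjointFl dCD aX).
move=> [[st hC] [_ hD]]; split=> // a /=; rewrite finset.in_setU out_eq.
case: ifP => [aC _|_ /= aD]; first by have := hC a aC; rewrite out_eq.
by have := hD a aD; rewrite out_eq.
Qed.

Lemma am_AE1P (a : AG) s (Y : set ST) :
  am_AE M [set a]%SET s Y <->
  Y !=set0 /\ exists sg, Y = am_out1 M a s sg.
Proof.
have outE sg : am_out M [set a]%SET s sg = am_out1 M a s sg.
  have [g ->] := ja_ofP sg (am_AC_inh M).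
  rewrite am_outE; apply/seteqP; split=> t.
    by move=> [_]; apply; rewrite /= finset.set11.
  move=> ht; split; first exact: am_out1_sub ht.
  by move=> b /= /finset.set1P ->.
split=> [[sg avsg <-]|[Y0 [sg Yeq]]].
  by split=> //; exists sg; rewrite outE.
by exists sg; rewrite ?outE // /am_av /= outE -Yeq.
Qed.

(** Agents choose their actions freely, so any family of individual effects comes from one joint
    action; nonemptiness of the intersection is the only constraint between agents. Conversely, each
    individual outcome set contains the nonempty joint one. *)
Lemma am_AEP C s (Y : set ST) :
  am_AE M C s Y <->
  Y !=set0 /\ exists F : AG -> set ST,
    (forall a, a \in C -> am_AE M [set a]%SET s (F a)) /\
    Y = am_suc M s `&` \bigcap_(a in [set` C]) F a.
Proof.
split.
  move=> [sg]; have [g ->] := ja_ofP sg (am_AC_inh M).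
  rewrite /am_av /= am_outE => Y0 <-; split=> //.
  exists (am_out_of s g); split=> // a aC; apply/am_AE1P; split.
    by case: Y0 => t [_ ht]; exists t; exact: ht.
  by exists (ja_of g [set a]%SET).
move=> [Y0 [F [hF Yeq]]].
(* A joint action of [[set a]] amounts to its value at [a]; agents outside [C] get an arbitrary
   action. *)
have /choice[g hg] : forall a, exists c : am_AC M,
    a \in C -> F a = am_out1 M a s (fun=> c).
  move=> a; have [aC|_] := boolP (a \in C); last first.
    by have [c] := am_AC_inh M; exists c.
  have /am_AE1P[_ [sg ->]] := hF a aC.
  exists (sg (exist _ a (finset.set11 a))) => _; congr am_out1.
  apply/funext => x; congr sg; apply/val_inj => /=.
  exact/finset.set1P/(valP x).
have outE : am_out M C s (ja_of g C) = Y.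
  rewrite am_outE Yeq; congr (_ `&` _); apply: eq_bigcapr => a aC.
  rewrite (hg a aC); congr am_out1; apply/funext => -[b hb].
  by rewrite /ja_of /=; move/finset.set1P: hb => ->.
by exists (ja_of g C); rewrite ?outE // /am_av /= outE.
Qed.

End ActionModelTheory.

(** * Iterated products and neighborhoods of coalitions *)

(** Nonemptiness of the whole intersection forces that of every partial one, so the checks made by
    [odot] at each stage collapse to the last. For a single family no product is formed, and
    nonemptiness comes from [~ Ds i0 set0]. *)
Lemma bigodotP (I : eqType) (T : Type) (Ds : I -> set (set T)) (i0 : I)
    (r : seq I) (Y : set T) :
  uniq (i0 :: r) -> ~ Ds i0 set0 ->
  bigodot [seq Ds i | i <- i0 :: r] Y <->
  Y !=set0 /\ exists F : I -> set T,
    (forall i, i \in i0 :: r -> Ds i (F i)) /\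
    Y = \bigcap_(i in [set` i0 :: r]) F i.
Proof.
(* [bigodot] is a left fold, so the induction removes the last family. *)
move=> /[swap] nD0; elim/last_ind: r Y => [|r j IH] Y.
  have E (F : I -> set T) : \bigcap_(i in [set` [:: i0]]) F i = F i0.
    apply/seteqP; split=> [t|t ht i /=]; first by apply; rewrite /= mem_head.
    by rewrite mem_seq1 => /eqP ->.
  move=> _ /=; split=> [DY|[_ [F [hF ->]]]]; last first.
    by rewrite E; apply: hF; rewrite mem_head.
  split; first by apply/set0P/eqP => Y0; rewrite Y0 in DY.
  by exists (fun=> Y); rewrite E; split=> // i; rewrite mem_seq1 => /eqP ->.
rewrite -rcons_cons rcons_uniq => /andP[jr ur].
have E (F : I -> set T) : \bigcap_(i in [set` rcons (i0 :: r) j]) F i =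
    (\bigcap_(i in [set` i0 :: r]) F i) `&` F j.
  apply/seteqP; split=> t => [ht|[ht hj] i]; rewrite /mkset.
    split=> [i ir|]; apply: ht; rewrite /mkset mem_rcons in_cons ?eqxx //.
    by apply/orP; right.
  by rewrite mem_rcons in_cons => /predU1P[->|]; [|exact: ht].
have -> : bigodot [seq Ds i | i <- rcons (i0 :: r) j] =
    odot (bigodot [seq Ds i | i <- i0 :: r]) (Ds j).
  by rewrite /= map_rcons foldl_rcons.
split=> [[Y1 [Y2 [/(IH _ ur)[_ [F [hF Y1E]]] h2 -> Y0]]]|[Y0 [F [hF YE]]]].
  (* Redefining [F] at [j] leaves the earlier factors intact because [j] does not occur among the
     earlier indices. *)
  split=> //; exists (fun i => if i == j then Y2 else F i); split=> [i|].
    by rewrite mem_rcons in_cons; case: eqP => [->|_] //=; exact: hF.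
  rewrite E eqxx Y1E; congr (_ `&` _); apply: eq_bigcapr => i /= ir.
  by case: eqP ir jr => // -> ->.
rewrite E in YE.
exists (\bigcap_(i in [set` i0 :: r]) F i), (F j).
rewrite -YE; split=> //; last by apply: hF; rewrite mem_rcons mem_head.
apply/(IH _ ur); split; first by move: Y0; rewrite YE => -[t [ht _]]; exists t.
exists F; split=> // i ir; apply: hF.
by rewrite mem_rcons in_cons ir orbT.
Qed.

Lemma nm_neiP (AG : finType) (AP : countType) (ST : Type)
    (N : nbhd_model AG AP ST) (C : {set AG}) (s : ST) (Y : set ST) :
  nm_nei N C s Y <->
  Y !=set0 /\ exists F : AG -> set ST,
    (forall a, a \in C -> nm_nei1 N a s (F a)) /\
    Y = nm_suc N s `&` \bigcap_(a in [set` C]) F a.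
Proof.
rewrite /nm_nei; case: asboolP => [s0|/eqP/set0P s0].
  by split=> // -[[t Yt] [F [_ YE]]]; move: Yt; rewrite YE s0 => -[].
case: eqP => [->|/eqP/set0Pn[b bC]].
  have E (F : AG -> set ST) : nm_suc N s `&`
      \bigcap_(a in [set` finset.set0]) F a = nm_suc N s.
    by apply/seteqP; split=> [t []//|t st]; split=> // a /=; rewrite finset.inE.
  split=> [->|[_ [F [_ ->]]]]; last by rewrite E.
  split=> //; exists (fun=> set0); rewrite E; split=> // a.
  by rewrite finset.inE.
have E (F : AG -> set ST) : (forall a, a \in C -> nm_nei1 N a s (F a)) ->
    \bigcap_(a in [set` enum C]) F a =
    nm_suc N s `&` \bigcap_(a in [set` C]) F a.
  move=> hF; apply/seteqP; split=> [t ht|t [_ ht] a]; last first.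
    by rewrite /= mem_enum => ?; exact: ht.
  split=> [|a aC]; last by apply: ht; rewrite /= mem_enum.
  (* The member [b] of [C] puts the intersection inside [nm_suc N s], as its neighborhoods cover
     that set. *)
  rewrite -(nm_cover N b s); exists (F b); first exact: hF.
  by apply: ht; rewrite /= mem_enum.
have := enum_uniq C; have := mem_enum C.
case: (enum C) E => [|a0 r] E memE ur; first by move: (memE b); rewrite bC.
rewrite (bigodotP _ ur (@nm_nonempty _ _ _ N a0 s)).
split=> -[Y0 [F [hF YE]]]; split=> //; exists F; last first.
  by split=> [a|]; [rewrite memE; exact: hF | rewrite E].
have hF' a : a \in C -> nm_nei1 N a s (F a) by rewrite -memE; exact: hF.
by split=> //; rewrite -E.
Qed.

(** * Transfer of the model properties *)

Section Representation.
Variables (AG : finType) (AP : countType) (ST : Type).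
Variables (M : action_model AG AP ST) (N : nbhd_model AG AP ST).

Lemma z_representable_single :
  am_L M = nm_L N -> am_suc M = nm_suc N ->
  (forall (a : AG) s, am_AE M [set a]%SET s = nm_nei1 N a s) ->
  z_representable M N.
Proof.
move=> eqL eqsuc eq1; split=> // C; apply/funext => s; apply/funext => Y.
apply/propext; rewrite am_AEP nm_neiP eqsuc.
by split=> -[Y0 [F [hF YE]]]; split=> //; exists F; split=> // a aC;
  [rewrite -eq1 | rewrite eq1]; exact: hF.
Qed.

Hypothesis MN : z_representable M N.

Lemma z_representable_serial : am_serial M <-> nm_serial N.
Proof.
have [_ eqAE] := MN; split=> h C s.
  by rewrite -eqAE; have [sg avsg] := h C s; exists (am_out M C s sg), sg.
by have := h C s; rewrite -eqAE => -[_ [sg avsg _]]; exists sg.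
Qed.

(** By [am_outU], the union of two joint actions is available exactly when their outcome sets
    meet. *)
Lemma z_representable_independent : am_independent M <-> nm_independent N.
Proof.
have [_ eqAE] := MN; split=> h s C D dCD.
  move=> Y1 Y2; rewrite -!eqAE => -[sg avsg <-] [tau avtau <-].
  by rewrite -am_outU //; exact: h.
move=> sg tau avsg avtau; rewrite /am_av /= am_outU //.
by apply: (h s C D dCD); rewrite -eqAE; [exists sg|exists tau].
Qed.

Lemma z_representable_deterministic : am_deterministic M <-> nm_deterministic N.
Proof.
have [_ eqAE] := MN; split=> h s.
  by move=> Y; rewrite -eqAE => -[sg avsg <-]; exact: h.
by move=> sg avsg; apply: (h s); rewrite -eqAE; exists sg.
Qed.

Lemma z_representable_X (X : ES) : action_X_model X M <-> nbhd_X_model X N.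
Proof.
split=> -[hS hI hD]; split=> [/hS|/hI|/hD].
- by rewrite z_representable_serial.
- by rewrite z_representable_independent.
- by rewrite z_representable_deterministic.
- by rewrite z_representable_serial.
- by rewrite z_representable_independent.
- by rewrite z_representable_deterministic.
Qed.

End Representation.

(** * Construction of the two models *)

Lemma action_model_z_representable (AG : finType) (AP : countType) (ST : Type)
    (M : action_model AG AP ST) :
  exists N : nbhd_model AG AP ST, z_representable M N.
Proof.
(* [AE_a] drops only empty outcome sets, which contribute nothing to the union. *)
have cover (a : AG) s : \bigcup_(Y in am_AE M [set a]%SET s) Y = am_suc M s.
  rewrite -(am_cover M a s); apply/seteqP; split=> t.
    by move=> [Y /am_AE1P[_ [sg ->]] ht]; exists sg.
  move=> [sg _ ht]; exists (am_out1 M a s sg) => //.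
  by apply/am_AE1P; split; [exists t|exists sg].
have nonempty (a : AG) s : ~ am_AE M [set a]%SET s set0.
  by move=> /am_AE1P[[]].
exists (NbhdModel (am_ST_inh M) (am_L M) cover nonempty).
exact: z_representable_single.
Qed.

Lemma nbhd_model_z_representing (AG : finType) (AP : countType) (ST : Type)
    (N : nbhd_model AG AP ST) :
  exists M : action_model AG AP ST, z_representable M N.
Proof.
pose act (a : AG) (sg : JA (set ST) [set a]%SET) :=
  sg (exist _ a (finset.set11 a)).
pose out a s sg := [set t | nm_nei1 N a s (act a sg) /\ act a sg t].
have outE a s sg : nm_nei1 N a s (act a sg) -> out a s sg = act a sg.
  by move=> h; apply/seteqP; split=> [t []|t].
have cover (a : AG) s : \bigcup_sg out a s sg = nm_suc N s.
  rewrite -(nm_cover N a s); apply/seteqP; split=> t.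
    by move=> [sg _ [h ht]]; exists (act a sg).
  by move=> [Y hY Yt]; exists (fun=> Y).
exists (ActionModel (nm_ST_inh N) (inhabits set0) (nm_L N) cover).
apply: z_representable_single => // a s; apply/seteqP; split=> Y.
  by move=> /am_AE1P[[t Yt] [sg YE]]; move: Yt; rewrite YE => -[h _] /=;
    rewrite outE.
move=> hY; apply/am_AE1P; split.
  by apply/set0P/eqP => Y0; rewrite Y0 in hY; exact: nm_nonempty hY.
by exists (fun=> Y); rewrite /= outE.
Qed.

Theorem theorem4p14 (AG : finType) (hAG : 0 < #|AG|) (AP : countType) (X : ES) :
  (forall (ST : Type) (M : action_model AG AP ST),
      action_X_model X M ->
      exists N : nbhd_model AG AP ST, nbhd_X_model X N /\ z_representable M N) /\
  (forall (ST : Type) (N : nbhd_model AG AP ST),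
      nbhd_X_model X N ->
      exists M : action_model AG AP ST, action_X_model X M /\ z_representable M N).
Proof.
split=> ST.
  move=> M XM; have [N MN] := action_model_z_representable M.
  by exists N; split=> //; apply/(z_representable_X MN X).
move=> N XN; have [M MN] := nbhd_model_z_representing N.
by exists M; split=> //; apply/(z_representable_X MN X).
Qed.
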